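(* Let $\mathcal{A}$ be a nonzero $C^*$-algebra and let $x$ and $y$ be two elements of a pre-Hilbert $\mathcal{A}$-module. Then any two of the following statements imply the third one: (i) $\|x+y\|^2+\|x-y\|^2=2(\|x\|^2+\|y\|^2)$. (ii) $S_{|x|^2}(\mathcal{A})\cap S_{|y|^2}(\mathcal{A})\neq\emptyset$. (iii) $S_{|x+y|^2}(\mathcal{A})\cap S_{|x-y|^2}(\mathcal{A})\neq\emptyset$.
   Context: A (right) pre-Hilbert $\mathcal{A}$-module $\mathscr{E}$ is a complex linear space that is a right $\mathcal{A}$-module with compatible scalar multiplication, equipped with an $\mathcal{A}$-valued inner product $\langle\cdot,\cdot\rangle$ (conjugate-linear in the first and linear in the second variable) such that $\langle x,x\rangle\ge 0$ with equality iff $x=0$, $\langle x,y\rangle^*=\langle y,x\rangle$, and $\langle x,ya\rangle=\langle x,y\rangle a$. Completeness is not assumed. For $x\in\mathscr{E}$, $|x|:=\langle x,x\rangle^{1/2}\in\mathcal{A}$ and $\|x\|:=\||x|\|_{\mathcal{A}}$. $S(\mathcal{A})$ is the set of states of $\mathcal{A}$, and for $a\in\mathcal{A}$, $S_a(\mathcal{A})=\{\varphi\in S(\mathcal{A}):|\varphi(a)|=\|a\|\}$. *)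

(* Defs.v *)
From HB Require Import structures.
From mathcomp Require Import all_boot all_order all_algebra.
From mathcomp Require Export complex.
From mathcomp Require Import all_classical all_reals all_analysis.
Import Order.TTheory GRing.Theory Num.Theory.
Import numFieldNormedType.Exports.

Set Implicit Arguments.
Unset Strict Implicit.
Unset Printing Implicit Defensive.

Local Open Scope classical_set_scope.
Local Open Scope ring_scope.

(* C*-algebras are complex (the scalar field is R[i], with R the reals) and not
   assumed unital, so the product cannot be that of a pzRingType.  As usual
   for a normed module over R[i], norms are R[i]-valued (they are nonnegative
   reals of R[i]), and z^* is complex conjugation. *)
HB.mixin Record CompleteNormedModule_isCstarAlgebra (R : realType) A
    of CompleteNormedModule R[i] A := {
  cmul : A -> A -> A;
  cadj : A -> A;
  cmulA : forall a b c, cmul a (cmul b c) = cmul (cmul a b) c;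
  cmulDl : forall a b c, cmul (a + b) c = cmul a c + cmul b c;
  cmulDr : forall a b c, cmul a (b + c) = cmul a b + cmul a c;
  cmulZl : forall (z : R[i]) a b, cmul (z *: a) b = z *: cmul a b;
  cmulZr : forall (z : R[i]) a b, cmul a (z *: b) = z *: cmul a b;
  cmul_norm : forall a b, `|cmul a b| <= `|a| * `|b|;
  cadjD : forall a b, cadj (a + b) = cadj a + cadj b;
  cadjZ : forall (z : R[i]) a, cadj (z *: a) = z^* *: cadj a;
  cadjM : forall a b, cadj (cmul a b) = cmul (cadj b) (cadj a);
  cadjK : forall a, cadj (cadj a) = a;
  cstar_identity : forall a, `|cmul (cadj a) a| = `|a| ^+ 2
}.

#[short(type="cstarAlgType")]
HB.structure Definition CstarAlgebra (R : realType) :=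
  { A of CompleteNormedModule R[i] A
       & CompleteNormedModule_isCstarAlgebra R A }.

Section CstarAlgebra.
Context {R : realType} {A : cstarAlgType R}.
Implicit Types (a b : A) (z : R[i]) (phi : {scalar A}).

(* The unitization of A is A * R[i], where (a, z) stands for a + z 1. *)
Definition unitization_mul (u v : A * R[i]) : A * R[i] :=
  (cmul u.1 v.1 + u.2 *: v.1 + v.2 *: u.1, u.2 * v.2).

Definition unitization_invertible (u : A * R[i]) : Prop :=
  exists v, unitization_mul u v = (0, 1) /\ unitization_mul v u = (0, 1).

(* When A is already unital, taking the spectrum in the unitization only adds
   the point 0, which does not affect positivity. *)
Definition cspectrum a : set R[i] :=
  [set z | ~ unitization_invertible (a, - z)].

(* In the order of R[i], 0 <= z means that z is a nonnegative real. *)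
Definition cpositive a : Prop :=
  cadj a = a /\ (forall z, cspectrum a z -> 0 <= z).

(* A positive element has exactly one positive square root, so that the value
   chosen here is a ^ (1/2); the default 0 is only relevant to a that are not
   positive. *)
Definition csqrt a : A := xget 0 [set b | cpositive b /\ cmul b b = a].

Definition functional_norm phi : R :=
  sup [set complex.Re `|phi a| | a in [set a : A | `|a| <= 1]].

(* The supremum of an unbounded set is 0 by convention, hence the second
   condition includes the boundedness of phi. *)
Definition states : set {scalar A} :=
  [set phi : {scalar A} | (forall a, cpositive a -> 0 <= phi a) /\ functional_norm phi = 1].

Definition norming_states a : set {scalar A} :=
  [set phi : {scalar A} | states phi /\ `|phi a| = `|a|].

End CstarAlgebra.

(* Conjugate-linearity of the inner product in the first variable follows from
   hinnerDr, hinnerZr and hinnerC. *)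
HB.mixin Record Lmodule_isPreHilbert (R : realType) (A : cstarAlgType R) E
    of GRing.Lmodule R[i] E := {
  hact : E -> A -> E;
  hinner : E -> E -> A;
  hactDl : forall x y a, hact (x + y) a = hact x a + hact y a;
  hactDr : forall x a b, hact x (a + b) = hact x a + hact x b;
  hactM : forall x a b, hact x (cmul a b) = hact (hact x a) b;
  hactZl : forall (z : R[i]) x a, hact (z *: x) a = z *: hact x a;
  hactZr : forall (z : R[i]) x a, hact x (z *: a) = z *: hact x a;
  hinnerDr : forall x y1 y2, hinner x (y1 + y2) = hinner x y1 + hinner x y2;
  hinnerZr : forall (z : R[i]) x y, hinner x (z *: y) = z *: hinner x y;
  hinnerC : forall x y, cadj (hinner x y) = hinner y x;
  hinnerM : forall x y a, hinner x (hact y a) = cmul (hinner x y) a;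
  hinner_ge0 : forall x, cpositive (hinner x x);
  hinner_eq0 : forall x, hinner x x = 0 <-> x = 0
}.

#[short(type="preHilbertModType")]
HB.structure Definition PreHilbertModule (R : realType) (A : cstarAlgType R) :=
  { E of GRing.Lmodule R[i] E & Lmodule_isPreHilbert R A E }.

Section PreHilbertModule.
Context {R : realType} {A : cstarAlgType R} {E : preHilbertModType A}.

Definition habs (x : E) : A := csqrt (hinner x x).

Definition habs2 (x : E) : A := cmul (habs x) (habs x).

Definition hnorm (x : E) : R[i] := `|habs x|.

End PreHilbertModule.

(* Main.v *)
(* The equivalences are elementary once [|x|^2] is known to be [<x, x>]: a
   state [phi] satisfies [phi <z, z> <= ||z||^2], so it norms both [<z, z>] and
   [<w, w>] iff [phi <z, z> + phi <w, w> = ||z||^2 + ||w||^2], and [phi] respects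
   the parallelogram law.  A state witnessing (ii) then also witnesses (iii) and
   conversely.

   What remains is that a positive [a], defined by its spectrum, has a positive
   square root.  In the unitization, [sqrt (M - c)] exists for every self-adjoint
   [c] of norm at most [M], by iterating [s := (c + s^2) / (2 sqrt M)].  It thus
   suffices to prove [||M - a|| <= M] for [||a|| <= M], which is done without
   Gelfand theory.  If the least [rho >= M] bounding [c := M - a] were larger than
   [M], then [rho - c = a + (rho - M)] would be invertible, hence for small [e]
   [(rho - e)^2 - c^2 = (rho - c) (1 - e (rho - c)^-1) (rho - e + M - a)]
   would be a product of three elements with commuting self-adjoint square roots,
   i.e. a square [g^2]; but [c^2 + g^2 = (rho - e)^2] forces
   [||c|| <= rho - e]. *)
Require Import Defs.
From HB Require Import structures.
From mathcomp Require Import all_boot all_order all_algebra.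
From mathcomp Require Import all_classical all_reals all_analysis.
From mathcomp Require Import ssrAC ring lra.
Import Order.TTheory GRing.Theory Num.Theory.
Import numFieldNormedType.Exports.
Local Open Scope classical_set_scope.
Local Open Scope ring_scope.

Set Implicit Arguments.
Unset Strict Implicit.
Unset Printing Implicit Defensive.

(** * The norm and the involution of the unitization *)

Section CstarTheory.
Context {R : realType} {A : cstarAlgType R}.
Implicit Types (a b v : A) (z : R[i]).

Lemma cmul0l a : cmul 0 a = 0.
Proof. by apply: (addrI (cmul 0 a)); rewrite -cmulDl !addr0. Qed.

Lemma cmul0r a : cmul a 0 = 0.
Proof. by apply: (addrI (cmul a 0)); rewrite -cmulDr !addr0. Qed.

Lemma cadj0 : cadj (0 : A) = 0.
Proof. by apply: (addrI (cadj 0)); rewrite -cadjD !addr0. Qed.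

End CstarTheory.

(** * Norms as elements of the real field *)

Section ComplexNorm.
Context {R : realType} {V : normedZmodType R[i]}.
Implicit Types a b : V.

(** Norms are nonnegative reals inside [R[i]]; the real part moves them to [R], where the order is
    total and infima exist. *)
Definition cnorm a : R := complex.Re `|a|.

Lemma cnormE a : `|a| = (cnorm a)%:C%C.
Proof. by rewrite /cnorm RRe_real ?ger0_real. Qed.

Lemma cnorm_ge0 a : 0 <= cnorm a.
Proof. by rewrite -ler0c -cnormE. Qed.

Lemma cnorm0 : cnorm (0 : V) = 0.
Proof. by rewrite /cnorm normr0. Qed.

Lemma cnorm_le0 a : cnorm a <= 0 -> a = 0.
Proof.
move=> a0; apply/eqP; rewrite -normr_eq0 cnormE.
by have /eqP -> : cnorm a == 0 by rewrite eq_le a0 cnorm_ge0.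
Qed.

Lemma cnormD a b : cnorm (a + b) <= cnorm a + cnorm b.
Proof. by rewrite -lecR rmorphD /= -!cnormE ler_normD. Qed.

Lemma cnormN a : cnorm (- a) = cnorm a.
Proof. by rewrite /cnorm normrN. Qed.

End ComplexNorm.

Section CstarNorm.
Context {R : realType} {A : cstarAlgType R}.
Implicit Types (a b v : A) (z : R[i]).

Lemma cnorm_mul z (t : R[i]) : cnorm (z * t) = cnorm z * cnorm t.
Proof.
by apply: (@complexI R); rewrite (rmorphM (real_complex R)) -!cnormE normrM.
Qed.

Lemma cnorm_conj z : cnorm z^* = cnorm z.
Proof. by rewrite /cnorm norm_conjC. Qed.

Lemma cnorm_real (r : R) : cnorm r%:C%C = `|r|.
Proof. by rewrite /cnorm normc_def /= expr0n addr0 sqrtr_sqr. Qed.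

Lemma cnormM a b : cnorm (cmul a b) <= cnorm a * cnorm b.
Proof. by rewrite -lecR rmorphM /= -!cnormE cmul_norm. Qed.

Lemma cnormZ z a : cnorm (z *: a) = cnorm z * cnorm a.
Proof.
by rewrite {1}/cnorm normrZ !cnormE /= mul0r subr0.
Qed.

Lemma cnorm_adjM a : cnorm (cmul (cadj a) a) = cnorm a ^+ 2.
Proof. by apply: (@complexI R); rewrite rmorphXn /= -!cnormE cstar_identity. Qed.

(** The C*-identity gives [||b||^2 = ||b^* b|| <= ||b^*|| ||b||]; cancel [||b||], then exchange [b]
    and [b^*]. *)
Lemma cnorm_adj a : cnorm (cadj a) = cnorm a.
Proof.
suff le b : cnorm b <= cnorm (cadj b).
  by apply: le_anti; rewrite le -{2}(cadjK a) le.
have [b0|b0] := ltP 0 (cnorm b); last exact: le_trans b0 (cnorm_ge0 _).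
by rewrite -(ler_pM2r b0) -expr2 -cnorm_adjM cnormM.
Qed.

End CstarNorm.

(** * The unitization as an involutive algebra acting on [A], with its norms *)

Definition unitization (R : realType) (A : cstarAlgType R) : Type :=
  (A * R[i])%type.

Section Unitization.
Context {R : realType} {A : cstarAlgType R}.
Implicit Types (a b v : A) (z : R[i]).

HB.instance Definition _ := GRing.Lmodule.copy (unitization A) (A * R[i])%type.

Implicit Types u w : unitization A.

Let one : unitization A := (0, 1).
Let mul u w : unitization A := unitization_mul u w.

Let mulA : associative mul.
Proof.
move=> [a z] [b w] [c t]; rewrite /mul /unitization_mul /=.
congr pair; last by rewrite mulrA.
rewrite !cmulDl !cmulDr !scalerDr !cmulZl !cmulZr cmulA !scalerA (mulrC t z) (mulrC t w).
by rewrite [LHS](AC (3*3*1) ((1*4*2*5)*(3*6*7))).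
Qed.

Let mul1u : left_id one mul.
Proof.
by case=> a z; rewrite /mul /unitization_mul /=
  cmul0l scaler0 scale1r mul1r !(add0r, addr0).
Qed.

Let mulu1 : right_id one mul.
Proof.
by case=> a z; rewrite /mul /unitization_mul /=
  cmul0r scaler0 scale1r mulr1 !(add0r, addr0).
Qed.

Let mulDl : left_distributive mul +%R.
Proof.
move=> [a z] [b w] [c t]; congr pair => /=; last exact: mulrDl.
rewrite cmulDl scalerDl scalerDr.
by rewrite [LHS](AC (2*2*2) ((1*3*5)*(2*4*6))).
Qed.

Let mulDr : right_distributive mul +%R.
Proof.
move=> [a z] [b w] [c t]; congr pair => /=; last exact: mulrDr.
rewrite cmulDr scalerDl scalerDr.
by rewrite [LHS](AC (2*2*2) ((1*3*5)*(2*4*6))).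
Qed.

Let one_neq0 : one != 0.
Proof. by apply/eqP => /(congr1 snd) /eqP; rewrite oner_eq0. Qed.

HB.instance Definition _ :=
  GRing.Zmodule_isNzRing.Build (unitization A) mulA mul1u mulu1 mulDl mulDr one_neq0.

Let scaleAl (z : R[i]) u w : z *: (u * w) = (z *: u) * w.
Proof.
case: u w => [a s] [b t]; congr pair; last exact: mulrA.
rewrite /=.
by rewrite !scalerDr cmulZl !scalerA (mulrC z t).
Qed.

HB.instance Definition _ :=
  GRing.Lmodule_isLalgebra.Build R[i] (unitization A) scaleAl.

Let scaleAr (z : R[i]) u w : z *: (u * w) = u * (z *: w).
Proof.
case: u w => [a s] [b t]; congr pair; last exact: mulrCA.
rewrite /=.
by rewrite !scalerDr cmulZr !scalerA (mulrC z s).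
Qed.

HB.instance Definition _ :=
  GRing.Lalgebra_isAlgebra.Build R[i] (unitization A) scaleAr.

Definition uadj u : unitization A := (cadj u.1, u.2^*).

Lemma uadjD u w : uadj (u + w) = uadj u + uadj w.
Proof. by congr pair; rewrite /= ?cadjD ?rmorphD. Qed.

Lemma uadjM u w : uadj (u * w) = uadj w * uadj u.
Proof.
congr pair; last by rewrite /= rmorphM mulrC.
by rewrite /= !cadjD cadjM !cadjZ addrAC.
Qed.

Lemma uadjZ z u : uadj (z *: u) = z^* *: uadj u.
Proof. by congr pair; rewrite /= ?cadjZ ?rmorphM. Qed.

Lemma uadjZr (r : R) u : uadj (r%:C%C *: u) = r%:C%C *: uadj u.
Proof. by rewrite uadjZ (CrealP _) // complex_real. Qed.

Lemma uadjN u : uadj (- u) = - uadj u.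
Proof. by rewrite -scaleN1r uadjZ rmorphN rmorph1 scaleN1r. Qed.

Lemma uadj1 : uadj 1 = 1.
Proof. by congr pair; rewrite /= ?cadj0 ?rmorph1. Qed.

Definition uact u v : A := cmul u.1 v + u.2 *: v.

Lemma uactD u w v : uact (u + w) v = uact u v + uact w v.
Proof. by rewrite /uact cmulDl scalerDl addrACA. Qed.

Lemma uactZ z u v : uact (z *: u) v = z *: uact u v.
Proof. by rewrite /uact cmulZl scalerDr scalerA. Qed.

Lemma uactM u w v : uact (u * w) v = uact u (uact w v).
Proof.
rewrite /uact /= !cmulDl cmulDr scalerDr cmulA !cmulZl cmulZr scalerA.
by rewrite [LHS](AC (3*1) ((1*3)*(2*4))).
Qed.

(** Through the C*-identity of [A], this turns knowledge of [uadj u * u] into a bound on [u] as an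
    operator. *)
Lemma uact_adjM u v :
  cmul (cadj (uact u v)) (uact u v) = cmul (cadj v) (uact (uadj u * u) v).
Proof.
rewrite uactM; move: {2 3}(uact u v) => w.
by rewrite /uact cadjD cadjM cadjZ cmulDl cmulDr -cmulA cmulZl cmulZr.
Qed.

(** The l1-norm of the direct sum: submultiplicative and complete, but in general not a C*-norm. *)
Definition unorm u : R := cnorm u.1 + cnorm u.2.

Lemma unorm_ge0 u : 0 <= unorm u.
Proof. by rewrite addr_ge0 ?cnorm_ge0. Qed.

Lemma unorm_le0 u : unorm u <= 0 -> u = 0.
Proof.
case: u => a z; rewrite /unorm /= => le0.
by congr pair; apply: cnorm_le0; have := cnorm_ge0 a; have := cnorm_ge0 z; lra.
Qed.

Lemma unormD u w : unorm (u + w) <= unorm u + unorm w.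
Proof. by rewrite /unorm /=; have := cnormD u.1 w.1; have := cnormD u.2 w.2; lra. Qed.

Lemma unormN u : unorm (- u) = unorm u.
Proof. by rewrite /unorm /= !cnormN. Qed.

Lemma unormM u w : unorm (u * w) <= unorm u * unorm w.
Proof.
rewrite /unorm /= cnorm_mul.
apply: (le_trans (lerD (cnormD _ _) (lexx _))).
have := cnormD (cmul u.1 w.1) (u.2 *: w.1); rewrite !cnormZ.
by have := cnormM u.1 w.1; rewrite mulrDl !mulrDr (mulrC (cnorm w.2)); lra.
Qed.

Lemma unormZ (r : R) u : unorm (r%:C%C *: u) = `|r| * unorm u.
Proof. by rewrite /unorm /= cnormZ cnorm_mul cnorm_real mulrDr. Qed.

Lemma unorm_adj u : unorm (uadj u) = unorm u.
Proof. by rewrite /unorm /= cnorm_adj cnorm_conj. Qed.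

(* The operator seminorm of left multiplication is not faithful on the
   unitization when [A] is already unital; its maximum with the modulus of the
   scalar part is a C*-norm in all cases. *)
Definition ubounded u (M : R) : Prop :=
  cnorm u.2 <= M /\ forall v, cnorm (uact u v) <= M * cnorm v.

Lemma ubounded_ge0 u M : ubounded u M -> 0 <= M.
Proof. by case=> + _; apply: le_trans; apply: cnorm_ge0. Qed.

Lemma ubounded_unorm u : ubounded u (unorm u).
Proof.
split=> [|v]; first by rewrite /unorm lerDr cnorm_ge0.
by rewrite mulrDl -cnormZ; apply: (le_trans (cnormD _ _)); rewrite lerD2r cnormM.
Qed.

(** For [u = a + z], [a a^* = u a^* - z a^*], so [||a||^2 <= 2 M ||a||]. With [ubounded_unorm], this
    makes [unorm] equivalent to the least admissible bound. *)
Lemma unorm_ubounded u M : ubounded u M -> unorm u <= 3 * M.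
Proof.
case=> u2 uM; suff : cnorm u.1 <= 2 * M by rewrite /unorm; lra.
have [a0|a0] := ltP 0 (cnorm u.1); last first.
  by have := cnorm_ge0 u.2; lra.
have := cnorm_adjM (cadj u.1); rewrite cadjK cnorm_adj => uu.
rewrite -(ler_pM2r a0) -expr2 -uu.
have -> : cmul u.1 (cadj u.1) = uact u (cadj u.1) - u.2 *: cadj u.1.
  by rewrite /uact addrK.
apply: (le_trans (cnormD _ _)); rewrite cnormN cnormZ.
have := uM (cadj u.1); rewrite cnorm_adj.
by have := ler_wpM2r (ltW a0) u2; lra.
Qed.

Lemma uboundedW u M N : M <= N -> ubounded u M -> ubounded u N.
Proof.
move=> MN [u2 uM]; split=> [|v]; first exact: le_trans MN.
by apply: (le_trans (uM v)); rewrite ler_wpM2r // cnorm_ge0.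
Qed.

Lemma uboundedD u w M N : ubounded u M -> ubounded w N -> ubounded (u + w) (M + N).
Proof.
move=> [u2 uM] [w2 wN]; split=> [|v].
  by apply: (le_trans (cnormD _ _)); apply: lerD.
by rewrite uactD mulrDl; apply: (le_trans (cnormD _ _)); apply: lerD.
Qed.

Lemma uboundedM u w M N : ubounded u M -> ubounded w N -> ubounded (u * w) (M * N).
Proof.
move=> uM wN; have M0 := ubounded_ge0 uM; case: uM wN => [u2 uM] [w2 wN].
split=> [|v]; first by rewrite /= cnorm_mul ler_pM ?cnorm_ge0.
by rewrite uactM -mulrA; apply: (le_trans (uM _)); rewrite ler_wpM2l.
Qed.

Lemma uboundedZ (r : R) u M : ubounded u M -> ubounded (r%:C%C *: u) (`|r| * M).
Proof.
move=> [u2 uM]; split=> [|v].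
  by rewrite /= cnorm_mul cnorm_real ler_wpM2l.
by rewrite uactZ cnormZ cnorm_real -mulrA ler_wpM2l.
Qed.

Lemma ubounded1 : ubounded 1 1.
Proof.
by rewrite /ubounded /uact /= cnorm_real; split=> [|v];
  rewrite ?normr1 ?mul1r ?cmul0l ?scale1r ?add0r.
Qed.

End Unitization.

(** * Completeness *)

Section Completeness.
Context {R : realType}.

Lemma cnorm_cauchy_cvg (V : completeNormedModType R[i]) (x : nat -> V) :
  (forall e : R, 0 < e -> exists K, forall k, (K <= k)%N -> cnorm (x k - x K) <= e) ->
  exists l, forall e : R, 0 < e ->
    exists K, forall k, (K <= k)%N -> cnorm (l - x k) <= e.
Proof.
move=> cx.
have : cvg (x @ \oo).
  apply/cauchy_cvgP/cauchy_exP => eps eps0.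
  have epsE : eps = (complex.Re eps)%:C%C by rewrite RRe_real ?gtr0_real.
  (* Halving [eps] turns the non-strict bound into the strict one of a ball. *)
  have [|K KP] := cx (complex.Re eps / 2).
    by rewrite divr_gt0 // -ltcR -epsE.
  exists (x K); exists K => // k /= /KP le; rewrite -ball_normE /= distrC cnormE.
  rewrite epsE ltcR; apply: (le_lt_trans le).
  by rewrite ltr_pdivrMr // ltr_pMr ?ltr1n // -ltcR -epsE.
move=> /cvg_ex [l xl]; exists l => e e0.
have /cvgrPdist_lt/(_ e%:C%C) := xl; rewrite ltcR => /(_ e0) [K _ KP].
by exists K => k /KP /=; rewrite cnormE ltcR => /ltW.
Qed.

Lemma real_cauchy_cvg (x : nat -> R) :
  (forall e : R, 0 < e -> exists K, forall k, (K <= k)%N -> `|x k - x K| <= e) ->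
  exists l, forall e : R, 0 < e ->
    exists K, forall k, (K <= k)%N -> `|l - x k| <= e.
Proof.
move=> cx.
have : cvg (x @ \oo).
  apply/cauchy_cvgP/cauchy_exP => eps eps0.
  have [|K KP] := cx (eps / 2); first by rewrite divr_gt0.
  exists (x K); exists K => // k /= /KP le; rewrite -ball_normE /= distrC.
  by apply: (le_lt_trans le); rewrite ltr_pdivrMr // ltr_pMr ?ltr1n.
move=> /cvg_ex [l xl]; exists l => e e0.
have /cvgrPdist_le/(_ e e0) [K _ KP] := xl.
by exists K => k /KP.
Qed.

Lemma cnorm_ge_Re (z : R[i]) : `|complex.Re z| <= cnorm z.
Proof. by rewrite -lecR -cnormE normc_ge_Re. Qed.

Lemma cnorm_ge_Im (z : R[i]) : `|complex.Im z| <= cnorm z.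
Proof.
have -> : complex.Im z = complex.Re (- 'i%C * z) by case: z => a b /=; ring.
apply: le_trans (cnorm_ge_Re _) _; rewrite cnorm_mul cnormN.
suff -> : cnorm ('i%C : R[i]) = 1 by rewrite mul1r.
by rewrite /cnorm normc_def /= expr0n expr1n add0r sqrtr1.
Qed.

Lemma cnorm_le_ReIm (z : R[i]) : cnorm z <= `|complex.Re z| + `|complex.Im z|.
Proof.
rewrite /cnorm normc_def /= -[leRHS]ger0_norm ?addr_ge0 // -sqrtr_sqr.
rewrite ler_sqrt ?sqr_ge0 // sqrrD !real_normK ?num_real // lerD2r lerDl.
by rewrite mulrn_wge0 // mulr_ge0.
Qed.

Lemma complex_cauchy_cvg (x : nat -> R[i]) :
  (forall e : R, 0 < e -> exists K, forall k, (K <= k)%N -> cnorm (x k - x K) <= e) ->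
  exists l, forall e : R, 0 < e ->
    exists K, forall k, (K <= k)%N -> cnorm (l - x k) <= e.
Proof.
move=> cx.
have [|lr lrP] := @real_cauchy_cvg (fun k => complex.Re (x k)).
  move=> e /cx [K KP]; exists K => k /KP; apply: le_trans => /=.
  by rewrite -raddfB cnorm_ge_Re.
have [|li liP] := @real_cauchy_cvg (fun k => complex.Im (x k)).
  move=> e /cx [K KP]; exists K => k /KP; apply: le_trans => /=.
  by rewrite -raddfB cnorm_ge_Im.
exists (Complex lr li) => e e0; have e20 : 0 < e / 2 by rewrite divr_gt0.
have [K1 K1P] := lrP _ e20; have [K2 K2P] := liP _ e20.
exists (maxn K1 K2) => k; rewrite geq_max => /andP[/K1P /= re /K2P /= im].
apply: (le_trans (cnorm_le_ReIm _)).
by rewrite !raddfB /=; lra.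
Qed.

Context {A : cstarAlgType R}.

Lemma unorm_cauchy_cvg (s : nat -> unitization A) :
  (forall e : R, 0 < e -> exists K, forall k, (K <= k)%N -> unorm (s k - s K) <= e) ->
  exists l, forall e : R, 0 < e ->
    exists K, forall k, (K <= k)%N -> unorm (l - s k) <= e.
Proof.
move=> cs.
have [|a aP] := @cnorm_cauchy_cvg A (fst \o s).
  move=> e /cs [K KP]; exists K => k /KP; apply: le_trans => /=.
  by rewrite /unorm lerDl cnorm_ge0.
have [|z zP] := @complex_cauchy_cvg (snd \o s).
  move=> e /cs [K KP]; exists K => k /KP; apply: le_trans => /=.
  by rewrite /unorm lerDr cnorm_ge0.
exists (a, z) => e e0; have e20 : 0 < e / 2 by rewrite divr_gt0.
have [K1 K1P] := aP _ e20; have [K2 K2P] := zP _ e20.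
exists (maxn K1 K2) => k; rewrite geq_max => /andP[/K1P /= re /K2P /= im].
by rewrite /unorm /=; lra.
Qed.

(* Domination by the increments of a bounded real sequence [t] replaces
   absolute convergence of a power series. *)
Lemma dominated_increments_cvg (s : nat -> unitization A) (t : nat -> R) (T : R) :
  (forall k, ubounded (s k.+1 - s k) (t k.+1 - t k)) -> (forall k, t k <= T) ->
  exists l, forall e : R, 0 < e ->
    exists K, forall k, (K <= k)%N -> unorm (l - s k) <= e.
Proof.
move=> st tT.
(* The increments telescope; as bounds are nonnegative, [t] is nondecreasing. *)
have stD k j : ubounded (s (k + j)%N - s k) (t (k + j)%N - t k).
  elim: j => [|j IH].
    rewrite addn0 !subrr; have := uboundedZ 0 (ubounded1 (A := A)).
    by rewrite scale0r normr0 mul0r.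
  have := uboundedD (st (k + j)%N) IH.
  by rewrite !addrA !subrK addnS.
have tcvg : cvg (t @ \oo).
  apply: nondecreasing_is_cvgn.
    move=> k l kl; have := ubounded_ge0 (stD k (l - k)%N).
    by rewrite subnKC // subr_ge0.
  by exists T => _ [k _ <-].
apply: unorm_cauchy_cvg => e e0.
have /cauchy_cvgP/cauchyP tc := tcvg.
(* Two late terms of [t] are within [e / 3] of each other, and [unorm_ubounded] costs a factor 3. *)
have [|r [K _ KP]] := tc (e / 6); first by rewrite divr_gt0.
exists K => k Kk; have := stD K (k - K)%N; rewrite subnKC // => /unorm_ubounded.
move=> /le_trans; apply.
have := KP k Kk; have := KP K (leqnn _).
rewrite -!ball_normE /= => /ltr_normlP [h1 h2] /ltr_normlP [h3 h4].
by lra.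
Qed.

End Completeness.

(** * Square roots and inverses by iteration *)

Section QuadraticFixpoint.
Context {R : realType} {A : cstarAlgType R}.
Implicit Types (u w p m s : unitization A).

Lemma le0_mul_small (x C : R) : (forall e, 0 < e -> x <= C * e) -> x <= 0.
Proof.
move=> xC; rewrite leNgt; apply/negP => x0.
have C0 : 0 < `|C| + 1 by rewrite ltr_wpDl.
(* For this [e], [C e <= x / 2 < x]; adding 1 to [|C|] covers [C = 0]. *)
have := xC (x / (`|C| + 1) / 2); rewrite !divr_gt0 // => /(_ isT).
apply/negP; rewrite -ltNge -mulrA mulrCA gtr_pMr // mulrA ltr_pdivrMr //.
by rewrite mul1r ltr_pdivrMr //; have := ler_norm C; have := normr_ge0 C; lra.
Qed.

Lemma ubounded_closed u (M : R) :
  (forall e, 0 < e -> ubounded u (M + e)) -> ubounded u M.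
Proof.
move=> uM; split=> [|v].
  rewrite -subr_le0; apply: (@le0_mul_small _ 1) => e /uM [u2 _].
  by rewrite mul1r lerBlDl.
rewrite -subr_le0; apply: (@le0_mul_small _ (cnorm v)) => e /uM [_ /(_ v)].
by rewrite mulrDl lerBlDl mulrC [e * _]mulrC.
Qed.

Lemma uadj_mul_comm u w :
  uadj u = u -> uadj w = w -> GRing.comm u w -> uadj (u * w) = u * w.
Proof. by move=> hu hw uw; rewrite uadjM hu hw uw. Qed.

Lemma commrZ u w (z : R[i]) : GRing.comm u w -> GRing.comm u (z *: w).
Proof. by rewrite /GRing.comm => uw; rewrite -scalerAl -scalerAr uw. Qed.

(** Majorant method: the iterates from 0 are dominated by those of [g t = P + M t + r t^2], which
    increase and stay below [T] because [g T <= T]. Commutation and self-adjointness hold for each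
    iterate and pass to the limit. The case [m = 0] yields square roots, the case [r = 0] Neumann
    inverses. *)
Lemma quadratic_fixpoint p m (P M r T : R) :
  0 <= r -> ubounded p P -> ubounded m M -> 0 <= T ->
  P + M * T + r * T ^+ 2 <= T ->
  exists s, [/\ ubounded s T, s = p + m * s + r%:C%C *: (s * s),
    forall w, GRing.comm w p -> GRing.comm w m -> GRing.comm w s &
    uadj p = p -> uadj m = m -> GRing.comm m p -> uadj s = s].
Proof.
move=> r0 pP mM T0 PMT.
pose f s := p + m * s + r%:C%C *: (s * s); pose s_ k := iter k f 0.
pose g t := P + M * t + r * t ^+ 2; pose t_ k := iter k g 0.
have P0 := ubounded_ge0 pP; have M0 := ubounded_ge0 mM.
have rN : `|r| = r by rewrite ger0_norm.
have t0 k : 0 <= t_ k by elim: k => //= k IH; rewrite /g !addr_ge0 ?mulr_ge0 ?exprn_ge0.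
have tT k : t_ k <= T.
  elim: k => //= k IH; apply: le_trans PMT; rewrite /g -!addrA lerD2l.
  by rewrite lerD // ler_wpM2l // ?lerXn2r ?nnegrE.
have st k : ubounded (s_ k) (t_ k).
  elim: k => [|k IH] /=.
    by have := uboundedZ 0 (ubounded1 (A := A)); rewrite scale0r normr0 mul0r.
  apply: uboundedD; first by apply: uboundedD => //; exact: uboundedM.
  by have := uboundedZ r (uboundedM IH IH); rewrite rN -expr2.
(* Based on [s^2 - s'^2 = s (s - s') + (s - s') s'], valid without commutativity. It serves both to
   dominate the increments and to bound [f] near the limit. *)
have fB s s' : f s - f s' = m * (s - s') +
    r%:C%C *: (s * (s - s') + (s - s') * s').
  rewrite !mulrBr mulrBl addrA subrK scalerBr /f.
  by rewrite !opprD addrACA [p + _ + _]addrACA subrr add0r.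
have incr k : ubounded (s_ k.+1 - s_ k) (t_ k.+1 - t_ k).
  elim: k => [|k IH].
    by rewrite !subr0 /= /f /g !(mulr0, scaler0, addr0, expr0n).
  rewrite -[s_ k.+2]/(f (s_ k.+1)) -[in X in _ - X]/(f (s_ k)) fB.
  have -> : t_ k.+2 - t_ k.+1 = M * (t_ k.+1 - t_ k) +
      `|r| * (t_ k.+1 * (t_ k.+1 - t_ k) + (t_ k.+1 - t_ k) * t_ k).
    rewrite rN.
    have -> : t_ k.+2 - t_ k.+1 = g (t_ k.+1) - g (t_ k) by [].
    by rewrite /g; ring.
  apply: uboundedD; first exact: uboundedM.
  by apply/uboundedZ/uboundedD; apply: uboundedM.
have [s sP] := dominated_increments_cvg incr tT.
have s3T k : unorm (s_ k) <= 3 * T.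
  by apply: le_trans (unorm_ubounded (st k)) _; have := tT k; lra.
have sE : s = f s.
  apply/eqP; rewrite -subr_eq0; apply/eqP/unorm_le0.
  (* The 1 accounts for [s - s_ K.+1]; the rest is a Lipschitz constant of [f] between [s] and
     [s_ K]. *)
  apply: (@le0_mul_small _ (1 + unorm m + r * (unorm s + 3 * T))) => e e0.
  have [K KP] := sP e e0; have h1 := KP K (leqnn _); have h2 := KP K.+1 (leqnSn _).
  have -> : s - f s = (s - s_ K.+1) - (f s - f (s_ K)) by rewrite opprB addrA subrK.
  apply: (le_trans (unormD _ _)); rewrite unormN fB -[1 + _ + _]addrA [leRHS]mulrDl mul1r.
  apply: lerD => //; apply: (le_trans (unormD _ _)); rewrite [leRHS]mulrDl; apply: lerD.
    by apply: (le_trans (unormM _ _)); rewrite ler_wpM2l ?unorm_ge0.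
  rewrite unormZ rN -mulrA ler_wpM2l //; apply: (le_trans (unormD _ _)).
  rewrite [leRHS]mulrDl [3 * T * e]mulrC; apply: lerD; apply: (le_trans (unormM _ _)).
    by rewrite ler_wpM2l ?unorm_ge0.
  by rewrite ler_pM ?unorm_ge0.
exists s; split => //.
- apply: ubounded_closed => e /sP [K /(_ K (leqnn _)) h].
  rewrite -(subrK (s_ K) s) addrC; apply: uboundedD; last exact: uboundedW (ubounded_unorm _).
  exact: uboundedW (st K).
- move=> w wp wm.
  have ws k : GRing.comm w (s_ k).
    elim: k => [|k IH] /=; first exact: commr0.
    by apply: commrD; [apply: commrD => //; exact: commrM|apply/commrZ/commrM].
  apply/eqP; rewrite -subr_eq0; apply/eqP/unorm_le0.
  apply: (@le0_mul_small _ (2 * unorm w)) => e /sP [K /(_ K (leqnn _)) h].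
  have -> : w * s - s * w = w * (s - s_ K) - (s - s_ K) * w.
    by rewrite mulrBr mulrBl ws opprB addrA subrK.
  apply: (le_trans (unormD _ _)); rewrite unormN.
  have := unormM w (s - s_ K); have := unormM (s - s_ K) w.
  have := ler_wpM2l (unorm_ge0 w) h; lra.
- move=> hp hm mp.
  have hs k : uadj (s_ k) = s_ k /\ GRing.comm m (s_ k).
    elim: k => [|k [IH1 IH2]] /=.
      by rewrite -(scale0r 1) uadjZr uadj1; split=> //; rewrite scale0r; exact: commr0.
    split; last by apply: commrD; [apply: commrD => //; exact: commrM|apply/commrZ/commrM].
    rewrite /f !uadjD uadjZr hp uadj_mul_comm ?uadjM ?IH1 //.
  apply/eqP; rewrite -subr_eq0; apply/eqP/unorm_le0.
  apply: (@le0_mul_small _ 2) => e /sP [K /(_ K (leqnn _)) h].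
  have -> : uadj s - s = uadj (s - s_ K) - (s - s_ K).
    by rewrite uadjD uadjN (hs K).1 opprB addrA subrK.
  by apply: (le_trans (unormD _ _)); rewrite unormN unorm_adj; lra.
Qed.
End QuadraticFixpoint.

(** * Roots of [M - c], Neumann inverses and roots of products *)

Section SquareRoots.
Context {R : realType} {A : cstarAlgType R}.
Implicit Types (u w c g h s : unitization A) (a b : A).

(** With [N = sqrt M], the equation [s = (c + s^2) / (2 N)] amounts to [(N - s)^2 = M - c], and
    [T = N] is a fixed point of the scalar majorant [(M + T^2) / (2 N)]. The bound on [s] later
    shows that the root is positive. *)
Lemma square_root_sub c (M : R) : 0 < M -> uadj c = c -> ubounded c M ->
  exists s, let g := (Num.sqrt M)%:C%C%:A - s in
    [/\ uadj s = s, ubounded s (Num.sqrt M), g * g = M%:C%C%:A - c &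
        forall w, GRing.comm w c -> GRing.comm w s].
Proof.
move=> M0 hc cM; set N := Num.sqrt M.
have N0 : 0 < N by rewrite sqrtr_gt0.
have NN : M = N * N by rewrite -expr2 sqr_sqrtr // ltW.
pose r := (2 * N)^-1; have r0 : 0 < r by rewrite invr_gt0 mulr_gt0.
have m0 := uboundedZ 0 (ubounded1 (A := A)); rewrite scale0r normr0 mul0r in m0.
have [||s [sN sE sc sa]] :=
    quadratic_fixpoint (T := N) (ltW r0) (uboundedZ r cM) m0.
- exact: ltW.
- rewrite gtr0_norm // mul0r addr0 NN /r; rewrite le_eqVlt; apply/orP; left; apply/eqP; field.
  by rewrite gt_eqF.
exists s; split=> // [||w wc].
- by apply: sa; rewrite ?uadjZr ?hc //; [rewrite -(scale0r 1) uadjZr uadj1|exact/commr_sym/commr0].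
- have sE2 : (2 * N)%:C%C *: s = c + s * s.
    rewrite {1}sE mul0r addr0 -scalerDr scalerA -rmorphM /= mulfV ?scale1r //.
    by rewrite gt_eqF // mulr_gt0.
  rewrite mulrBl !mulrBr -!scalerAl -!scalerAr !mul1r mulr1 scalerA -rmorphM -NN.
  rewrite -addrA; congr +%R.
  have -> : c = (2 * N)%:C%C *: s - s * s by rewrite sE2 addrK.
  by rewrite mulr_natl mulr2n rmorphD scalerDl -opprD addrA.
- by apply: sc; [exact: commrZ|exact: commr0].
Qed.

(** The case [r = 0], [p = 1] of the fixpoint: [y = 1 + u y], majorized by [1 + q T = T] at
    [T = 1 / (1 - q)]. *)
Lemma neumann_inverse u (q : R) : q < 1 -> ubounded u q ->
  exists y, (1 - u) * y = 1 /\ y * (1 - u) = 1.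
Proof.
move=> q1 uq; have q10 : 0 < 1 - q by rewrite subr_gt0.
have [||y [_ yE yu _]] := quadratic_fixpoint (T := (1 - q)^-1) (lexx 0) ubounded1 uq.
- by rewrite invr_ge0 ltW.
- by rewrite mul0r addr0; rewrite le_eqVlt; apply/orP; left; apply/eqP; field; rewrite gt_eqF.
have {}yE : y - u * y = 1 by rewrite {1}yE scale0r addr0 addrK.
have uy : GRing.comm u y by apply: yu; [exact: commr1|].
by exists y; rewrite mulrBl mulrBr mul1r mulr1 -uy yE.
Qed.

(* [h + i g] and its adjoint are [M] times a unitary. *)
Lemma ubounded_sum_squares h g (M : R) : 0 <= M ->
  uadj h = h -> uadj g = g -> GRing.comm h g ->
  h * h + g * g = (M ^+ 2)%:C%C%:A -> cnorm h.2 <= M -> ubounded h M.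
Proof.
move=> M0 hh hg hgC hgM h2; split=> // v.
(* [k] stands for [i] and [- i]; the cross terms cancel since [h] and [g] commute, leaving
   [h^2 + g^2]. *)
have key (k : R[i]) : k ^* = - k -> k * k = -1 ->
    cnorm (uact (h + k *: g) v) <= M * cnorm v.
  move=> kJ kk; rewrite -(@ler_pXn2r _ 2) ?nnegrE ?cnorm_ge0 ?mulr_ge0 ?cnorm_ge0 //.
  rewrite -cnorm_adjM uact_adjM uadjD uadjZ hh hg kJ.
  have -> : (h + - k *: g) * (h + k *: g) = (M ^+ 2)%:C%C%:A.
    rewrite mulrDl !mulrDr -!scalerAl -!scalerAr scalerA mulNr kk opprK scale1r.
    by rewrite hgC scaleNr addrA -[_ + _ - _]addrA subrr addr0 hgM.
  rewrite uactZ /uact /= cmul0l add0r scale1r cmulZr cnormZ cnorm_real.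
  by rewrite ger0_norm ?exprn_ge0 // cnorm_adjM exprMn.
have iJ : ('i : R[i])^* = - 'i by rewrite conjCi.
have ii : ('i : R[i]) * 'i = -1 by rewrite -expr2 sqrCi.
have h1 := key 'i iJ ii.
have h2' : cnorm (uact (h - 'i *: g) v) <= M * cnorm v.
  by rewrite -scaleNr; apply: key; [rewrite rmorphN; congr (- _)|rewrite mulrNN].
(* [h] is the mean of [h + i g] and [h - i g]. *)
have -> : uact h v = (2^-1)%:C%C *: (uact (h + 'i *: g) v + uact (h - 'i *: g) v).
  rewrite -uactD addrACA subrr addr0 uactD -[X in _ *: X]mulr2n.
  rewrite -[X in _ *: X]scaler_nat scalerA -(rmorph_nat (real_complex R)) -rmorphM /=.
  by rewrite mulVf ?scale1r // pnatr_eq0.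
rewrite cnormZ cnorm_real gtr0_norm ?invr_gt0 //.
by have := cnormD (uact (h + 'i *: g) v) (uact (h - 'i *: g) v); lra.
Qed.

(** The commutation clause makes any two such roots for the same [c] commute with each other, so
    that products of elements with roots have roots. *)
Definition has_root c u : Prop :=
  exists g, [/\ uadj g = g, g * g = u & forall w, GRing.comm w c -> GRing.comm w g].

Lemma has_rootM c u w : has_root c u -> has_root c w -> has_root c (u * w).
Proof.
move=> [g [ga <- gc]] [h [ha <- hc]].
have gh : GRing.comm g h by apply/hc/commr_sym/gc.
exists (g * h); split; first exact: uadj_mul_comm.
- by rewrite mulrA -(mulrA g) -gh !mulrA.
- by move=> x xc; apply: commrM; [exact: gc|exact: hc].
Qed.

Lemma has_root_sub c c' u : (forall w, GRing.comm w c -> GRing.comm w c') ->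
  has_root c' u -> has_root c u.
Proof. by move=> cc' [g [ga gu gc]]; exists g; split=> // w /cc'/gc. Qed.

Lemma has_root_square_root_sub c (M : R) : 0 < M -> uadj c = c -> ubounded c M ->
  has_root c (M%:C%C%:A - c).
Proof.
move=> M0 hc cM; have [s [sa _ sE sc]] := square_root_sub M0 hc cM.
eexists; split; [|exact: sE|].
- by rewrite uadjD uadjN sa uadjZr uadj1.
- by move=> w wc; apply: commrB; [exact/commrZ/commr1|exact: sc].
Qed.

End SquareRoots.

(** * Square roots of positive elements *)

Section PositiveSquareRoot.
Context {R : realType} {A : cstarAlgType R}.
Implicit Types (u w c : unitization A) (a b : A).

Definition uinj a : unitization A := (a, 0).

Lemma uinjB a z : (a, - z) = uinj a - z%:A.
Proof. by congr pair; rewrite /= ?scaler0 ?subr0 // sub0r [_ *: _]mulr1. Qed.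

Lemma cpositive_invertible a z : cpositive a -> ~ (0 <= z) ->
  exists w, (uinj a - z%:A) * w = 1 /\ w * (uinj a - z%:A) = 1.
Proof. by case=> _ + nz; move=> /(_ z) az; rewrite -uinjB; apply: contrapT => /az. Qed.

Lemma invertible_factor u w v : GRing.comm u w -> u * w * v = 1 -> v * (u * w) = 1 ->
  exists y, u * y = 1 /\ y * u = 1.
Proof.
move=> uw uwv vuw; exists (w * v); split; first by rewrite mulrA.
(* [w v = v (u w) w v = v w (u w v) = v w], so the right inverse of [u] is also a left inverse. *)
have -> : w * v = v * w.
  rewrite -[LHS]mul1r -{1}vuw -!mulrA (mulrA u w (w * v)) uw -(mulrA w).
  by rewrite (mulrA u) uwv mulr1.
by rewrite -mulrA -uw.
Qed.

(** Converts the spectral definition of positivity into the norm bound that [square_root_sub]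
    requires. *)
Lemma positive_ubounded_sub a (M : R) : cpositive a -> 0 < M -> cnorm a <= M ->
  ubounded (M%:C%C%:A - uinj a) M.
Proof.
move=> a_pos M0 aM; have [ha _] := a_pos.
set c := _ - _.
have hr (r : R) : uadj (r%:C%C%:A : unitization A) = r%:C%C%:A.
  by rewrite uadjZr uadj1.
have hca : uadj (uinj a) = uinj a by congr pair; rewrite /= ?ha ?conjC0.
have hc : uadj c = c by rewrite uadjD uadjN hr hca.
have c2 : cnorm c.2 = M.
  by rewrite /= subr0 [_ *: _]mulr1 cnorm_real gtr0_norm.
have cE : c = M%:C%C%:A - uinj a by [].
clearbody c.
(* By [ubounded_closed] the infimum [rho] is itself a bound, so it remains to exclude [M < rho]. *)
pose S : set R := [set x | M <= x /\ ubounded c x].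
have S_inf : has_inf S.
  split; last by exists M => x [].
  exists (unorm c); split; last exact: ubounded_unorm.
  by rewrite -c2; case: (ubounded_unorm c).
pose rho := inf S.
have Mrho : M <= rho by apply: lb_le_inf; [case: S_inf|move=> x []].
have crho : ubounded c rho.
  apply: ubounded_closed => e e0; have [x [_ cx] /ltW xe] := inf_adherent e0 S_inf.
  exact: uboundedW cx.
have [rhoM|Mltrho] := leP rho M; first exact: uboundedW crho.
exfalso.
have rho0 : 0 < rho by exact: lt_le_trans Mrho.
(* [M - rho < 0] is not in the spectrum of [a], so [rho - c = a - (M - rho)] has an inverse [y]. *)
have [|y] := @cpositive_invertible a (M - rho)%:C%C a_pos.
  by rewrite ler0c subr_ge0 leNgt Mltrho.
set d := _ - _; case=> dy yd.
have dE : d = rho%:C%C%:A - c.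
  by rewrite /d cE rmorphB scalerBl !opprB [RHS]addrCA.
clearbody d.
have hd : uadj d = d by rewrite dE uadjD uadjN hr hc.
have hy : uadj y = y.
  by rewrite -[LHS]mulr1 -dy mulrA -{1}hd -uadjM dy uadj1 mul1r.
have cd : GRing.comm c d by rewrite dE; apply: commrB => //; exact/commrZ/commr1.
have wy w : GRing.comm w c -> GRing.comm w y.
  move=> wc; have wd : GRing.comm w d.
    by rewrite dE; apply: commrB => //; exact/commrZ/commr1.
  by rewrite /GRing.comm -[LHS]mul1r -yd -!mulrA (mulrA d) -wd -!mulrA dy mulr1.
(* The first term of the minimum keeps [rho - e >= M]; the second makes [||e y|| <= 1], so that
   [1 - e y] has a root. *)
pose e := Num.min (rho - M) (1 + unorm y)^-1.
have y0 : 0 < 1 + unorm y by rewrite ltr_pwDl ?unorm_ge0.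
have e0 : 0 < e by rewrite lt_min subr_gt0 Mltrho invr_gt0.
have erho : e <= rho - M by rewrite ge_min lexx.
have ey : ubounded (e%:C%C *: y) 1.
  apply: uboundedW (uboundedZ e (ubounded_unorm y)).
  rewrite gtr0_norm //; apply: (@le_trans _ _ (e * (1 + unorm y))).
    by apply: ler_wpM2l; [exact: ltW|rewrite lerDr].
  by rewrite -ler_pdivlMr // mul1r ge_min lexx orbT.
have r1 : has_root c d by rewrite dE; apply: has_root_square_root_sub.
have r2 : has_root c (1 - e%:C%C *: y).
  apply: (@has_root_sub _ _ _ (e%:C%C *: y)) => [w /wy|]; first exact: commrZ.
  rewrite -[X in X - _]scale1r; apply: has_root_square_root_sub => //.
  by rewrite uadjZr hy.
(* [rho - e + c = (rho - e + M) - a], and [||a|| <= M <= rho - e + M]. *)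
have r3 : has_root c ((rho - e)%:C%C%:A + c).
  apply: (@has_root_sub _ _ _ (uinj a)) => [w wc|].
    have -> : uinj a = M%:C%C%:A - c by rewrite cE opprB addrCA subrr addr0.
    by apply: commrB => //; exact/commrZ/commr1.
  have -> : (rho - e)%:C%C%:A + c = (rho - e + M)%:C%C%:A - uinj a.
    by rewrite cE (rmorphD _ (rho - e)) scalerDl -addrA.
  apply: has_root_square_root_sub => //; first by lra.
  apply: uboundedW (ubounded_unorm _).
  by rewrite /unorm /= cnorm0 addr0; lra.
have [g [hg gE gc]] := has_rootM (has_rootM r1 r2) r3.
have : ubounded c (rho - e).
  apply: (ubounded_sum_squares (g := g)) => //; [lra|exact: gc| |by rewrite c2; lra].
  (* As [d y = 1], [g^2 = (d - e) (rho - e + c) = (rho - e)^2 - c^2]. *)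
  rewrite gE mulrBr mulr1 -scalerAr dy {1}dE.
  have -> : rho%:C%C%:A - c - e%:C%C%:A = (rho - e)%:C%C%:A - c.
    by rewrite rmorphB scalerBl addrAC.
  rewrite mulrBl !mulrDr -!scalerAl -!scalerAr !mul1r !mulr1 scalerA -rmorphM -expr2.
  by rewrite addrKA addrC subrK.
move=> cre; have : inf S <= rho - e.
  by apply: ge_inf; [case: S_inf|split=> //; lra].
by rewrite -/rho; lra.
Qed.

Lemma positive_square_root a : cpositive a ->
  exists b, cpositive b /\ cmul b b = a.
Proof.
move=> a_pos; have [ha _] := a_pos.
(* The added 1 keeps [M] positive when [a = 0]. *)
pose M := cnorm a + 1; have M0 : 0 < M by rewrite ltr_wpDl ?cnorm_ge0.
have cM : ubounded (M%:C%C%:A - uinj a) M.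
  by apply: positive_ubounded_sub => //; rewrite lerDl.
have [|s] := square_root_sub M0 _ cM.
  rewrite uadjD uadjN uadjZr uadj1; congr (_ - _).
  by congr pair; rewrite /= ?ha ?conjC0.
set N := Num.sqrt M; set u := _ - s => -[hs sN uu _].
rewrite subKr in uu.
have uN : u = N%:C%C%:A - s by [].
clearbody u.
have N0 : 0 < N by rewrite sqrtr_gt0.
have hu : uadj u = u by rewrite uN uadjD uadjN hs uadjZr uadj1.
(* The scalar part of [u^2 = a] is 0, hence so is that of [u]: the root lies in [A]. *)
have u2 : u.2 = 0.
  by apply/eqP; have /(congr1 snd)/eqP := uu; rewrite [_.2]/= mulf_eq0 orbb.
have uE : u = uinj u.1 by rewrite /uinj -u2; case: (u).
exists u.1; split; last first.
  by have /(congr1 fst) := uu; rewrite /= u2 !scale0r !addr0.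
split; first by have /(congr1 fst) := hu.
move=> z /=; rewrite /cspectrum /= uinjB -uE; apply: contra_notP => nz.
suff [y [uy yu]] : exists y, (u - z%:A) * y = 1 /\ y * (u - z%:A) = 1 by exists y.
(* For nonreal [z], [z^2] is not a nonnegative real, so [a - z^2 = (u - z) (u + z)] is invertible,
   and with it the factor [u - z]. *)
have [zR|zNR] := boolP (z \is Num.real); last first.
  have [|v [h1 h2]] := @cpositive_invertible a (z ^+ 2) a_pos.
    by move=> z2; move: zNR; rewrite realEsqr z2.
  have uzE : uinj a - (z ^+ 2)%:A = (u - z%:A) * (u + z%:A).
    by rewrite mulrDr !mulrBl uu -!scalerAl -!scalerAr !mul1r !mulr1 scalerA -expr2 addrA subrK.
  rewrite uzE in h1 h2; apply: invertible_factor h1 h2.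
  apply: commrD; last by exact/commrZ/commr1.
  by apply: commr_sym; apply: commrB => //; exact/commrZ/commr1.
have zE : z = (complex.Re z)%:C%C by rewrite RRe_real.
move: nz; set t := complex.Re z in zE; rewrite zE ler0c => /negP; rewrite -ltNge => t0.
(* For [t < 0], [u - t = k - s] with [||s|| <= N < k], so a Neumann inverse exists. *)
pose k := N - t; have k0 : 0 < k by rewrite /k; lra.
have [||y [h1 h2]] := @neumann_inverse _ _ (k^-1%:C%C *: s) (k^-1 * N).
- by rewrite mulrC ltr_pdivrMr // mul1r /k; lra.
- by rewrite -{2}(gtr0_norm (_ : 0 < k^-1)) ?invr_gt0 //; exact: uboundedZ.
have ukE : u - t%:C%C%:A = k%:C%C *: (1 - k^-1%:C%C *: s).
  rewrite scalerBr scalerA -rmorphM /= mulfV ?gt_eqF // scale1r.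
  by rewrite uN /k rmorphB scalerBl addrAC.
exists (k^-1%:C%C *: y); rewrite ukE -!scalerAl -!scalerAr !scalerA h1 h2 -!rmorphM /=.
by rewrite mulVf ?mulfV ?gt_eqF // !scale1r.
Qed.
End PositiveSquareRoot.

(** * States and pre-Hilbert modules *)

Section States.
Context {R : realType} {A : cstarAlgType R}.
Implicit Types (phi : {scalar A}) (a : A).

Lemma state_le_norm phi a : states phi -> `|phi a| <= `|a|.
Proof.
case=> _ phi1; have [->|a0] := eqVneq a 0; first by rewrite linear0 !normr0.
set S := [set complex.Re `|phi b| | b in [set b : A | `|b| <= 1]] in phi1.
(* A set without supremum has [sup] 0 by default, so norm 1 forces boundedness. *)
have supS : has_sup S.
  apply: contrapT => /sup_out; move: phi1; rewrite /functional_norm -/S => ->.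
  by move/eqP; rewrite oner_eq0.
have na : 0 < `|a| by rewrite normr_gt0.
have /(sup_upper_bound supS) : S (complex.Re `|phi (`|a|^-1 *: a)|).
  by exists (`|a|^-1 *: a) => //=; rewrite normrZ normfV normr_id mulVf ?gt_eqF.
rewrite [sup S]phi1 -lecR -[complex.Re _]/(cnorm _) -cnormE linearZ normrM normfV normr_id.
by rewrite mulrC ler_pdivrMr // mul1r.
Qed.

Lemma norming_states_positive phi a : cpositive a ->
  norming_states a phi <-> states phi /\ phi a = `|a|.
Proof.
move=> a_pos; split=> -[phi_state]; last by move=> pa; split; rewrite // pa normr_id.
by move=> <-; split=> //; rewrite ger0_norm //; case: phi_state => + _; apply.
Qed.

End States.

(** * Inner products, their norms and their values under states *)

Section PreHilbert.
Context {R : realType} {A : cstarAlgType R} {E : preHilbertModType A}.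
Implicit Types x y : E.

(** Since a positive root exists, [csqrt] does not fall back on its default 0. *)
Lemma habsP x : cpositive (habs x) /\ habs2 x = hinner x x.
Proof.
by have := positive_square_root (hinner_ge0 x); rewrite /habs2 /habs => /(xgetPex 0).
Qed.

Lemma hnorm_sqr x : hnorm x ^+ 2 = `|hinner x x|.
Proof.
by have [[ha _] <-] := habsP x; rewrite /habs2 -{1}ha cstar_identity.
Qed.

Lemma hinnerDl x y z : hinner (x + y) z = hinner x z + hinner y z.
Proof. by rewrite -hinnerC hinnerDr cadjD !hinnerC. Qed.

Lemma hinnerNr x y : hinner x (- y) = - hinner x y.
Proof. by rewrite -scaleN1r hinnerZr scaleN1r. Qed.

Lemma hinnerNl x y : hinner (- x) y = - hinner x y.
Proof. by rewrite -hinnerC hinnerNr -scaleN1r cadjZ rmorphN rmorph1 scaleN1r hinnerC. Qed.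

Lemma hinner_parallelogram x y :
  hinner (x + y) (x + y) + hinner (x - y) (x - y) =
  (hinner x x + hinner y y) *+ 2.
Proof.
rewrite !hinnerDl !hinnerDr !hinnerNr !hinnerNl opprK.
rewrite addrACA [X in X + _]addrACA [X in _ + X]addrACA !subrr addr0 add0r.
by rewrite addrACA -mulr2n.
Qed.

Lemma state_hinner_le (phi : {scalar A}) x : states phi ->
  phi (hinner x x) <= `|hinner x x|.
Proof.
move=> phi_state; rewrite -[leLHS]ger0_norm ?state_le_norm //.
by case: phi_state => + _; apply; exact: hinner_ge0.
Qed.

(** Each value of a state is at most the norm, so equality of the sums forces equality of the terms.
    Two norming conditions thus become one linear equation, to which the parallelogram law
    applies. *)
Lemma norming_states_hinner2 (phi : {scalar A}) x y : states phi ->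
  (norming_states (hinner x x) `&` norming_states (hinner y y)) phi <->
  phi (hinner x x) + phi (hinner y y) = `|hinner x x| + `|hinner y y|.
Proof.
move=> phi_state; have le z := state_hinner_le z phi_state; rewrite /setI /=.
rewrite !norming_states_positive; try exact: hinner_ge0.
split=> [[[_ ->] [_ ->]] //|eqD].
have eqx : phi (hinner x x) = `|hinner x x|.
  by apply/le_anti; rewrite le -(lerD2r `|hinner y y|) -eqD lerD2l le.
by split; split=> //; move: eqD; rewrite eqx => /addrI.
Qed.

End PreHilbert.

Theorem corollary2p6 (R : realType) (A : cstarAlgType R)
    (A_nonzero : exists a : A, a != 0) (E : preHilbertModType A) (x y : E) :
  let i := hnorm (x + y) ^+ 2 + hnorm (x - y) ^+ 2 =
           2 * (hnorm x ^+ 2 + hnorm y ^+ 2) in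
  let ii := norming_states (habs2 x) `&` norming_states (habs2 y) !=set0 in
  let iii := norming_states (habs2 (x + y)) `&` norming_states (habs2 (x - y))
             !=set0 in
  (i -> ii -> iii) /\ (i -> iii -> ii) /\ (ii -> iii -> i).
Proof.
rewrite /= !hnorm_sqr !(habsP _).2.
have phi_sum (phi : {scalar A}) :
    phi (hinner (x + y) (x + y)) + phi (hinner (x - y) (x - y)) =
    2 * (phi (hinner x x) + phi (hinner y y)).
  by rewrite -linearD hinner_parallelogram linearMn linearD mulr_natl.
have two0 : (2 : R[i]) != 0 by rewrite pnatr_eq0.
have state2 (phi : {scalar A}) (z w : E) :
    (norming_states (hinner z z) `&` norming_states (hinner w w)) phi -> states phi.
  by case=> -[].
have le_sum (phi : {scalar A}) (z w : E) : states phi ->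
    phi (hinner z z) + phi (hinner w w) <= `|hinner z z| + `|hinner w w|.
  by move=> phi_state; apply: lerD; exact: state_hinner_le.
split; last split.
- move=> eq_i [phi phiP]; have phi_state := state2 _ _ _ phiP.
  exists phi; apply/norming_states_hinner2 => //.
  by rewrite phi_sum eq_i; congr (_ * _); apply/norming_states_hinner2.
- move=> eq_i [phi phiP]; have phi_state := state2 _ _ _ phiP.
  exists phi; apply/norming_states_hinner2 => //.
  by apply: (mulfI two0); rewrite -phi_sum -eq_i; apply/norming_states_hinner2.
- move=> [phi phiP] [psi psiP].
  have phi_state := state2 _ _ _ phiP; have psi_state := state2 _ _ _ psiP.
  have /norming_states_hinner2 phiE := phiP; have /norming_states_hinner2 psiE := psiP.
  (* The two states may differ, and each yields one inequality: [psi], norming for [x + y] and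
     [x - y], gives [<=]; [phi], norming for [x] and [y], gives [>=]. *)
  apply/le_anti/andP; split.
    by rewrite -psiE // phi_sum ler_pM2l ?ltr0n // le_sum.
  by rewrite -phiE // -phi_sum le_sum.
Qed.
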